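(* Let $\mathcal{L}$ be a signature containing at least one constant symbol. Let $\mathcal{V}$ be a coherent variety of $\mathcal{L}$-algebras with a term-definable meet-semilattice reduct (with associated order $\le$), and let $t(x)$ be a unary $\mathcal{L}$-term satisfying $$\mathcal{V}\models t(x)\le x\quad\text{and}\quad\mathcal{V}\models x\le y\Rightarrow t(x)\le t(y).$$ Suppose also that $\mathcal{V}$ satisfies the following fixpoint embedding condition with respect to $t(x)$: for any finitely generated $\mathbf{A}\in\mathcal{V}$ and $a\in A$, there exists an algebra $\mathbf{B}\in\mathcal{V}$ such that $\mathbf{A}$ is a subalgebra of $\mathbf{B}$ and the meet $\bigwedge_{k\in\mathbb{N}}t^k(a)$ exists in $\mathbf{B}$ and satisfies $$\bigwedge_{k\in\mathbb{N}}t^k(a)=t\Bigl(\bigwedge_{k\in\mathbb{N}}t^k(a)\Bigr).$$ Then there exists $n\in\mathbb{N}$ such that $t$ is $n$-potent in $\mathcal{V}$, i.e. $\mathcal{V}\models t^{n+1}(x)\approx t^n(x)$.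
   Context: For a unary term $t$: $t^0(x)=x$ and $t^{k+1}(x)=t(t^k(x))$ for $k\in\mathbb{N}$ (with $0\in\mathbb{N}$). A term-definable meet-semilattice reduct means a binary term $\wedge$ that is a semilattice operation on every member of $\mathcal{V}$; $x\le y$ means $x\wedge y\approx x$. $\mathcal{V}$ is coherent if every finitely generated subalgebra of a finitely presented member of $\mathcal{V}$ is finitely presented, where finitely presented means isomorphic to $\mathbf{F}(\overline{x})/\Theta$ with $\mathbf{F}(\overline{x})$ the free algebra of $\mathcal{V}$ over a finite set $\overline{x}$ and $\Theta$ a finitely generated congruence. *)

(* Defs.v *)
From HB Require Import structures.
From mathcomp Require Import all_boot.
From mathcomp Require Import boolp classical_sets cardinality.

Set Implicit Arguments.
Unset Strict Implicit.
Unset Printing Implicit Defensive.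

Local Open Scope classical_set_scope.
Local Open Scope quotient_scope.

(* Signatures of arbitrary size with finitary operation symbols. *)
Record signature := Signature { symbol :> Type; arity : symbol -> nat }.

(* Carriers may be empty in general; over a signature with a constant symbol
   every algebra (and every subuniverse) is inhabited. *)
Record algebra (S : signature) := Algebra {
  carrier :> Type;
  opr : forall f : S, ('I_(arity f) -> carrier) -> carrier }.
Arguments opr {S a}.

Inductive term (S : signature) (X : Type) :=
| Var of X
| App (f : S) of ('I_(arity f) -> term S X).
Arguments Var S {X}.
Arguments App {S X}.

Definition term_algebra (S : signature) (X : Type) : algebra S :=
  @Algebra S (term S X) App.

Fixpoint eval (S : signature) (A : algebra S) (X : Type) (v : X -> A)
    (s : term S X) : A :=
  match s with
  | Var x => v x
  | App f args => opr f (fun i => eval v (args i))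
  end.

Section Constructions.
Variable S : signature.
Implicit Types A B : algebra S.

Definition is_hom A B (h : A -> B) : Prop :=
  forall (f : S) (a : 'I_(arity f) -> A), h (opr f a) = opr f (h \o a).

Definition isomorphic A B : Prop := exists2 h : A -> B, is_hom h & bijective h.

Definition subuniverse A (B : set A) : Prop :=
  forall (f : S) (a : 'I_(arity f) -> A), (forall i, B (a i)) -> B (opr f a).

Definition sub_algebra A (B : set A) (HB : subuniverse B) : algebra S :=
  @Algebra S {x : A | B x}
    (fun f a => exist _ (opr f (fun i => sval (a i)))
                  (HB f _ (fun i => svalP (a i)))).

Definition finitely_generated A : Prop :=
  exists2 G : set A, finite_set G & smallest (@subuniverse A) G = [set: A].

Definition prod_algebra (I : Type) (A : I -> algebra S) : algebra S :=
  @Algebra S (forall i, A i) (fun f a i => opr f (fun j => a j i)).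

Definition is_congruence A (R : set (A * A)) : Prop :=
  [/\ forall x, R (x, x),
      forall x y, R (x, y) -> R (y, x),
      forall x y z, R (x, y) -> R (y, z) -> R (x, z)
    & forall (f : S) (a b : 'I_(arity f) -> A),
        (forall i, R (a i, b i)) -> R (opr f a, opr f b)].

Definition fg_congruence A (R : set (A * A)) : Prop :=
  exists2 G : set (A * A), finite_set G & R = smallest (@is_congruence A) G.

Section Quotient.
Variables (A : algebra S) (R : set (A * A)) (HR : is_congruence R).

Let rel_of : rel {classic A} := fun x y => `[< R (x, y) >].

Fact congruence_refl : reflexive rel_of.
Proof. by case: HR => rR _ _ _ x; apply/asboolP/rR. Qed.

Fact congruence_sym : symmetric rel_of.
Proof.
by case: HR => _ sR _ _ x y; apply/asboolP/asboolP => ?; apply: sR.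
Qed.

Fact congruence_trans : transitive rel_of.
Proof.
case: HR => _ _ tR _ y x z /asboolP xy /asboolP yz.
by apply/asboolP; apply: tR xy yz.
Qed.

Definition congruence_equiv : equiv_rel {classic A} :=
  EquivRel rel_of congruence_refl congruence_sym congruence_trans.

Definition quotient_algebra : algebra S :=
  @Algebra S {eq_quot congruence_equiv}
    (fun f a => \pi_({eq_quot congruence_equiv})
                  (opr f (fun i => repr (a i) : A) : {classic A})).

End Quotient.

Record variety (V : algebra S -> Prop) : Prop := Variety {
  variety_image : forall A B (h : A -> B),
    V A -> is_hom h -> (forall b, exists a, h a = b) -> V B;
  variety_sub : forall A (B : set A) (HB : subuniverse B),
    V A -> V (sub_algebra HB);
  variety_prod : forall (I : Type) (A : I -> algebra S),
    (forall i, V (A i)) -> V (prod_algebra A) }.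

Section InVariety.
Variable V : algebra S -> Prop.

Definition satisfies (X : Type) (s t : term S X) : Prop :=
  forall A, V A -> forall v : X -> A, eval v s = eval v t.

Definition identities (X : Type) : set (term_algebra S X * term_algebra S X) :=
  [set st | satisfies st.1 st.2].

Lemma identities_congruence (X : Type) : is_congruence (@identities X).
Proof.
split=> [s|s t st|s t u st tu|f a b ab] A VA v //=.
- by rewrite (st A VA v).
- by rewrite (st A VA v) (tu A VA v).
- by congr (opr f); apply/funext => i; apply: ab.
Qed.

Definition free_algebra (X : Type) : algebra S :=
  quotient_algebra (@identities_congruence X).

Definition finitely_presented A : Prop :=
  exists (X : finType) (R : set (free_algebra X * free_algebra X))
         (HR : is_congruence R),
    fg_congruence R /\ isomorphic A (quotient_algebra HR).

Definition coherent : Prop :=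
  forall A, V A -> finitely_presented A ->
  forall (B : set A) (HB : subuniverse B),
    finitely_generated (sub_algebra HB) -> finitely_presented (sub_algebra HB).

(* Unary terms have the single variable [tt : unit]. *)
Definition op1 (t : term S unit) A (a : A) : A := eval (fun=> a) t.

(* Binary terms have the variables [true] (first) and [false] (second). *)
Definition op2 (m : term S bool) A (a b : A) : A :=
  eval (fun i : bool => if i then a else b) m.

(* [tpow t k] is the term t^k(x); evaluation in the term algebra is
   substitution. *)
Definition tpow (t : term S unit) (k : nat) : term S unit :=
  iter k (@op1 t (term_algebra S unit)) (Var S tt).

Definition potent (n : nat) (t : term S unit) : Prop :=
  satisfies (tpow t n.+1) (tpow t n).

Definition semilattice_term (m : term S bool) : Prop :=
  forall A, V A -> [/\ associative (@op2 m A), commutative (@op2 m A)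
                     & idempotent_op (@op2 m A)].

Definition leA (m : term S bool) A (x y : A) : Prop := op2 m x y = x.

Definition is_meet (m : term S bool) A (P : set A) (b : A) : Prop :=
  (forall x, P x -> leA m b x) /\
  (forall c, (forall x, P x -> leA m c x) -> leA m c b).

(* The inclusion of A as a subalgebra of B is an injective homomorphism. *)
Definition fixpoint_embedding (m : term S bool) (t : term S unit) : Prop :=
  forall A, V A -> finitely_generated A -> forall a : A,
  exists B, V B /\
  exists e : A -> B, [/\ is_hom e, injective e &
    exists2 b : B, is_meet m [set op1 (tpow t k) (e a) | k in [set: nat]] b
                 & b = op1 t b].

End InVariety.
End Constructions.

(* Main.v *)
(** Let A be presented by generators x, w, z with z <= w <= x and w = t(w), and
    let C be its subalgebra generated by x and z. By the fixpoint embedding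
    condition (take w to be the meet of the t^k(x)), the relations between x and
    z that hold in C are exactly the consequences of the chain z <= t^k(x),
    k = 0, 1, 2, ... By coherence C is finitely presented, so by compactness
    some z <= t^n(x) already implies z <= t^(n+1)(x) throughout V. Taking
    z = t^n(x) gives t^n(x) <= t^(n+1)(x) <= t^n(x). *)
Require Import Defs.
From mathcomp Require Import all_boot.
From mathcomp Require Import boolp classical_sets cardinality.

Set Implicit Arguments.
Unset Strict Implicit.
Unset Printing Implicit Defensive.

Local Open Scope classical_set_scope.
Local Open Scope quotient_scope.

(** * Homomorphisms, term evaluation, congruences and quotients *)

Section Homomorphisms.
Variable S : signature.
Implicit Types A B C : algebra S.

Lemma hom_eval A B (h : A -> B) X (v : X -> A) (s : term S X) :
  is_hom h -> h (eval v s) = eval (h \o v) s.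
Proof.
move=> hh; elim: s => [x|f args IH] //=.
by rewrite hh; congr (opr f); apply/funext => i /=; apply: IH.
Qed.

Lemma eval_hom A X (v : X -> A) : is_hom (eval v : term_algebra S X -> A).
Proof. by []. Qed.

Lemma hom_comp A B C (h : A -> B) (k : B -> C) :
  is_hom h -> is_hom k -> is_hom (k \o h).
Proof. by move=> hh hk f a /=; rewrite hh hk. Qed.

Lemma hom_op1 A B (h : A -> B) (t : term S unit) a :
  is_hom h -> h (op1 t a) = op1 t (h a).
Proof. by move=> hh; rewrite /op1 hom_eval. Qed.

Lemma hom_op2 A B (h : A -> B) (m : term S bool) a b :
  is_hom h -> h (op2 m a b) = op2 m (h a) (h b).
Proof.
move=> hh; rewrite /op2 hom_eval //; congr (eval _ m).
by apply/funext => -[].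
Qed.

Lemma op1_tpow A (t : term S unit) k (a : A) :
  op1 (tpow t k) a = iter k (@op1 S t A) a.
Proof.
elim: k => //= k IH; rewrite -IH.
exact: (hom_op1 (A := term_algebra S unit) t (tpow t k) (@eval_hom A unit (fun=> a))).
Qed.

Lemma eval_tpow A (t : term S unit) k (v : unit -> A) :
  eval v (tpow t k) = iter k (@op1 S t A) (v tt).
Proof. by rewrite -op1_tpow /op1; congr eval; apply/funext => -[]. Qed.

Lemma kernel_congruence A B (h : A -> B) :
  is_hom h -> is_congruence [set p : A * A | h p.1 = h p.2].
Proof.
move=> hh; split=> [x|x y|x y z|f a b ab] //=; first by move=> -> ->.
by rewrite !hh; congr (opr f); apply/funext => i; apply: ab.
Qed.

Lemma smallest_congruence A (G : set (A * A)) :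
  is_congruence (smallest (@is_congruence S A) G).
Proof.
split.
- by move=> x M [[r _ _ _] _]; apply: r.
- by move=> x y xy M MG; case: (MG) => -[_ s _ _] _; apply: s (xy M MG).
- move=> x y z xy yz M MG; case: (MG) => -[_ _ u _] _.
  by apply: u (xy M MG) (yz M MG).
- move=> f a b ab M MG; case: (MG) => -[_ _ _ u] _.
  by apply: u => i; apply: (ab i M MG).
Qed.

Section QuotientMap.
Variables (A : algebra S) (R : set (A * A)) (HR : is_congruence R).

Definition quot (a : A) : quotient_algebra HR :=
  \pi_({eq_quot congruence_equiv HR}) (a : {classic A}).

Lemma quot_eq a b : quot a = quot b <-> R (a, b).
Proof.
split; first by move/eqmodP/asboolP.
by move=> ab; apply/eqmodP/asboolP.
Qed.

Lemma quot_surj (q : quotient_algebra HR) : exists a, quot a = q.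
Proof. by exists (repr q : A); apply: reprK. Qed.

Lemma quot_hom : is_hom quot.
Proof.
move=> f a; apply/quot_eq; have [_ _ _ compat] := HR; apply: compat => i.
by apply/quot_eq; rewrite /quot reprK.
Qed.

Lemma quot_lift B (h : A -> B) : is_hom h ->
  (forall a b, R (a, b) -> h a = h b) ->
  exists2 h' : quotient_algebra HR -> B, is_hom h' & forall a, h' (quot a) = h a.
Proof.
move=> hh Rh; have [r rK] := choice quot_surj.
have E a : h (r (quot a)) = h a by apply/Rh/quot_eq; rewrite rK.
exists (h \o r) => // f a.
have -> : opr f a = quot (opr f (r \o a)).
  by rewrite quot_hom; congr (opr f); apply/funext => i /=; rewrite rK.
by rewrite /comp E hh.
Qed.

End QuotientMap.

Lemma eval_Var X (s : term S X) : eval (A := term_algebra S X) (Var S) s = s.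
Proof. by elim: s => //= f args IH; congr App; apply/funext. Qed.

Lemma eval_quot X (R : set (term_algebra S X * term_algebra S X))
    (HR : is_congruence R) s :
  eval (fun x => quot HR (Var S x)) s = quot HR s.
Proof. by rewrite -[in RHS](eval_Var s) (hom_eval _ s (quot_hom HR)). Qed.

(** * Subalgebras generated by a family *)

Lemma image_subuniverse A X (v : X -> A) :
  subuniverse [set a | exists s : term S X, eval v s = a].
Proof.
move=> f a /choice[s sE]; exists (App f s) => /=.
by congr (opr f); apply/funext.
Qed.

(** Taking the values of terms as carrier makes every element accessible through a term in the
    generators. *)
Definition generated A X (v : X -> A) : algebra S :=
  sub_algebra (@image_subuniverse A X v).

Definition gen A X (v : X -> A) (x : X) : generated v :=
  exist _ (v x) (ex_intro _ (Var S x) erefl).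

Lemma sval_hom A (B : set A) (HB : subuniverse B) :
  is_hom (fun a : sub_algebra HB => sval a).
Proof. by []. Qed.

Lemma sval_inj A (B : set A) (HB : subuniverse B) :
  injective (fun a : sub_algebra HB => sval a).
Proof. by move=> a b; apply: eq_sig_hprop => *; apply: Prop_irrelevance. Qed.

Lemma gen_surj A X (v : X -> A) (c : generated v) :
  exists s, eval (gen v) s = c.
Proof.
case: (c) => a [s sa]; exists s; apply: sval_inj.
by rewrite (hom_eval (gen v) s (sval_hom (HB := _))).
Qed.

Lemma generated_fg A (X : finType) (v : X -> A) :
  finitely_generated (generated v).
Proof.
exists (range (gen v)); first exact/finite_image/finite_finset.
apply/seteqP; split=> // c _ M [HM GM].
have [s <-] := gen_surj c.
by elim: s => [x|f args IH] /=; [apply: GM; exists x | apply: HM].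
Qed.

End Homomorphisms.

(** * Quotients of term algebras inside the variety *)

Section Variety.
Variables (S : signature) (V : algebra S -> Prop) (hV : variety V).
Implicit Types A B D : algebra S.

(** The term algebra itself need not lie in [V]. Instead the quotient is an image of the subalgebra
    [generated v] of [A], by choosing a term for each element. *)
Lemma quotient_kernel_variety A X (v : X -> A)
    (HK : is_congruence [set p : term_algebra S X * term_algebra S X |
                          eval v p.1 = eval v p.2]) :
  V A -> V (quotient_algebra HK).
Proof.
move=> VA; have VG : V (generated v) by apply: (variety_sub hV).
have [r rK] := choice (@gen_surj _ A X v).
have rE s : quot HK (r (eval (gen v) s)) = quot HK s.
  apply/quot_eq => /=; have := rK (eval (gen v) s).
  by move/(congr1 sval); rewrite !(hom_eval (gen v) _ (sval_hom (HB := _))).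
apply: (variety_image hV (h := quot HK \o r) VG) => [f a|q].
  have -> : opr f a = eval (gen v) (App f (r \o a)).
    by rewrite eval_hom; congr (opr f); apply/funext => i; rewrite /comp rK.
  by rewrite /comp rE (@quot_hom _ (term_algebra S X) _ HK f).
have [s <-] := quot_surj q.
by exists (eval (gen v) s); apply: rE.
Qed.

(* The free algebra is obtained as the image of the term algebra in the product
   of all its quotients that lie in V. *)
Lemma quotient_variety X (R : set (term_algebra S X * term_algebra S X))
    (HR : is_congruence R) :
  @identities S V X `<=` R -> V (quotient_algebra HR).
Proof.
move=> idR; pose T := term_algebra S X.
(* Indexing by congruences of [T], not by members of [V], keeps the product small; each [v : X -> A]
   with [A] in [V] is still represented, through the kernel of [eval v]. *)
pose I := {R : set (T * T) | exists HR : is_congruence R,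
             V (quotient_algebra HR)}.
have cI (i : I) : is_congruence (sval i) by case: i => ? [].
have VI (i : I) : V (quotient_algebra (cI i)).
  case: i (cI i) => Q /= [HQ VQ] HQ'.
  by rewrite (Prop_irrelevance HQ' HQ).
pose P := prod_algebra (fun i => quotient_algebra (cI i)).
pose g : X -> P := fun x i => quot (cI i) (Var S x : T).
have VP : V P by apply: (variety_prod hV).
have evg s i : eval g s i = quot (cI i) s.
  by rewrite (hom_eval g s (h := fun p : P => p i)) // -[RHS]eval_quot.
have kerg : [set p : T * T | eval g p.1 = eval g p.2] `<=` R.
  move=> [s s'] /= ss'; apply: idR => A VA v /=.
  have HK := kernel_congruence (@eval_hom _ A X v).
  pose i : I := exist _ _ (ex_intro _ HK (quotient_kernel_variety HK VA)).
  have := congr1 (fun p : P => p i) ss'; rewrite !evg.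
  by move/quot_eq.
have HK := kernel_congruence (@eval_hom _ P X g).
have [h hh hE] := quot_lift HK (@quot_hom _ _ _ HR)
  (fun a b ab => (quot_eq HR a b).2 (kerg (a, b) ab)).
apply: (variety_image hV (quotient_kernel_variety HK VP) hh) => q.
by have [s <-] := quot_surj q; exists (quot HK s); rewrite hE.
Qed.

(** * Presentations relative to the variety *)

Definition models A X I (E : I -> term S X * term S X) (v : X -> A) :=
  forall i, eval v (E i).1 = eval v (E i).2.

(** A universal property with relations between terms, in place of a congruence of the free algebra,
    so that it transports along isomorphisms and its relations can be evaluated in any algebra. *)
Definition presents A X I (E : I -> term S X * term S X) (v : X -> A) :=
  [/\ forall a, exists s, eval v s = a, models E v
    & forall D, V D -> forall w : X -> D, models E w ->
      exists2 h : A -> D, is_hom h & forall x, h (v x) = w x].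

Let free X := quot (@identities_congruence S V X).

Lemma eval_free X s : eval (fun x => free (Var S x)) s = @free X s.
Proof. exact: eval_quot. Qed.

(** An assignment satisfying [E] in a member of [V] extends to the free algebra because all
    identities hold there, then factors through [R] because the kernel of the extension is a
    congruence containing the relations. *)
Lemma quotient_presents (X I : Type) (E : I -> term S X * term S X)
    (R : set (free_algebra V X * free_algebra V X)) (HR : is_congruence R) :
  R = smallest (@is_congruence S _) (range (fun i => (free (E i).1, free (E i).2)))
  -> presents E (fun x => quot HR (free (Var S x))).
Proof.
move=> RE; set v := (X in presents _ X).
have evE s : eval v s = quot HR (free s).
  by rewrite -eval_free (hom_eval _ s (quot_hom HR)).
split=> [a|i|D VD w Ew].
- have [b <-] := quot_surj a; have [s <-] := quot_surj b.
  by exists s; rewrite evE.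
- rewrite !evE; apply/quot_eq; rewrite RE => M [_ EM].
  by apply: EM; exists i.
have [h hh hE] := quot_lift (@identities_congruence S V X)
  (@eval_hom _ D X w) (fun a b ab => ab D VD w).
have [k kk kE] : exists2 k : quotient_algebra HR -> D, is_hom k &
    forall a, k (quot HR a) = h a.
  apply: quot_lift => // a b; rewrite RE => /(_ [set p | h p.1 = h p.2]).
  apply; split; first exact: kernel_congruence.
  by move=> _ [i _ <-] /=; rewrite !hE.
by exists k => // x; rewrite kE hE.
Qed.

Lemma finitely_presented_presents A : finitely_presented V A ->
  exists (X : finType) n (E : 'I_n -> term S X * term S X) (v : X -> A),
    presents E v.
Proof.
move=> [X [R [HR [[G finG RG] [h hh [k hK kK]]]]]].
have [n [E GE]] : exists n (E : 'I_n -> term S X * term S X),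
    G = range (fun i => (free (E i).1, free (E i).2)).
  have [s Gs] := (finite_seqP (T := {classic _}) G).1 finG.
  (* A term chosen in each class of the free algebra turns the generating pairs of the congruence
     into equations. *)
  have [r rK] := choice (@quot_surj _ _ _ (@identities_congruence S V X)).
  pose p i := tnth (in_tuple s) i : free_algebra V X * free_algebra V X.
  exists (size s), (fun i => (r (p i).1, r (p i).2)).
  apply/seteqP; split=> [q|q [i _ <-]].
    rewrite Gs => /= /(@tnthP _ _ (in_tuple s))[i qi].
    by exists i => //; rewrite /free !rK /p -qi; case: (q).
  by rewrite /free !rK /= -surjective_pairing Gs /=; apply: mem_tnth.
rewrite GE in RG.
have [surj Ev univ] := quotient_presents HR RG.
set v := (X in models _ X) in Ev.
have hk : is_hom k.
  move=> f a; apply: (can_inj hK); rewrite kK hh.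
  by congr (opr f); apply/funext => i /=; rewrite kK.
exists X, n, E, (k \o v); split=> [a|i|D VD w Ew].
- have [s sE] := surj (h a).
  by exists s; rewrite -hom_eval // sE hK.
- by have := congr1 k (Ev i); rewrite !(hom_eval v _ hk).
have [l ll lE] := univ D VD w Ew.
exists (l \o h); first exact: hom_comp.
by move=> x /=; rewrite kK lE.
Qed.

Lemma presentation_exists (X I : finType) (E : I -> term S X * term S X) :
  exists A, [/\ V A, finitely_presented V A & exists v : X -> A, presents E v].
Proof.
pose G := range (fun i => (free (E i).1, free (E i).2)).
have HR := smallest_congruence G.
exists (quotient_algebra HR); split.
- apply: (variety_image hV _ (quot_hom HR) (@quot_surj _ _ _ HR)).
  exact: quotient_variety.
- exists X, _, HR; split; first by exists G => //; apply/finite_image/finite_finset.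
  by exists id => //; exists id.
by exists (fun x => quot HR (free (Var S x))); apply: quotient_presents.
Qed.

(** * Compactness along a chain of equations *)

Lemma uniform_bound (I : finType) (P : I -> nat -> Prop) :
  (forall i j k, j <= k -> P i j -> P i k) ->
  (forall i, exists k, P i k) -> exists k, forall i, P i k.
Proof.
move=> mono /choice[f fP]; exists (\max_i f i) => i.
exact: mono (leq_bigmax i) (fP i).
Qed.

(* The pairs that follow from some [H k] form a congruence of the term algebra,
   as arities are finite; the quotient is the generic model of all the [H k]. *)
Lemma chain_compactness (X : Type) (H : nat -> term S X * term S X) :
  (forall A, V A -> forall (v : X -> A) k,
     eval v (H k.+1).1 = eval v (H k.+1).2 ->
     eval v (H k).1 = eval v (H k).2) ->
  forall (I : finType) (E : I -> term S X * term S X),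
  (forall A, V A -> forall v : X -> A, models H v -> models E v) ->
  exists n, forall A, V A -> forall v : X -> A,
    eval v (H n).1 = eval v (H n).2 -> models E v.
Proof.
move=> Hdec I E HE; pose T := term_algebra S X.
pose Q k (p : T * T) := forall A, V A -> forall v : X -> A,
  eval v (H k).1 = eval v (H k).2 -> eval v p.1 = eval v p.2.
have Qmono p j k : j <= k -> Q j p -> Q k p.
  move/subnK <-; elim: (k - j) => // d IH Qj A VA v Hv.
  exact/(IH Qj A VA v)/(Hdec A VA v).
have HQ : is_congruence [set p : T * T | exists k, Q k p].
  split=> [s|s s' [k sk]|s s' s'' [j sj] [k sk]|f a b ab] /=.
  - by exists 0.
  - by exists k => A VA v Hv; rewrite (sk A VA v Hv).
  - exists (maxn j k) => A VA v Hv /=.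
    rewrite (Qmono _ _ _ (leq_maxl j k) sj A VA v Hv) /=.
    by rewrite (Qmono _ _ _ (leq_maxr j k) sk A VA v Hv).
  have [i j k|k kP] := uniform_bound (P := fun i k => Q k (a i, b i)) _ ab.
    exact: Qmono.
  exists k => A VA v Hv /=; congr (opr f); apply/funext => i.
  exact: kP.
have VQ : V (quotient_algebra HQ).
  by apply: quotient_variety => -[s s'] ss'; exists 0 => A VA v _; apply: ss'.
have [i j k|i|n nP] := uniform_bound (P := fun i k => Q k (E i)).
- exact: Qmono.
(* The quotient models every [H k], hence [E]; equality of classes there means being a consequence
   of some [H k]. *)
- have : models E (fun x => quot HQ (Var S x : T)).
    apply: HE => // k; rewrite !eval_quot; apply/quot_eq; exists k => A VA v.
    exact.
  by move=> /(_ i); rewrite !eval_quot => /quot_eq[k]; exists k.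
by exists n => A VA v Hv i; apply: nP Hv.
Qed.

(** A Tietze argument: a finite presentation on other generators, rewritten in the generators [g],
    gives finitely many equations [F] that follow from the whole chain, hence from one [H n].
    Conversely [F] yields a homomorphism from [A] carrying [g] to [d], along which every [H k]
    passes to [D]. *)
Lemma finitely_presented_chain (X : finType) (H : nat -> term S X * term S X)
    A (g : X -> A) :
  (forall A, V A -> forall (v : X -> A) k,
     eval v (H k.+1).1 = eval v (H k.+1).2 ->
     eval v (H k).1 = eval v (H k).2) ->
  (forall a, exists s, eval g s = a) -> models H g ->
  (forall D, V D -> forall d : X -> D, models H d ->
     forall s s', eval g s = eval g s' -> eval d s = eval d s') ->
  finitely_presented V A ->
  exists n, forall D, V D -> forall d : X -> D,
    eval d (H n).1 = eval d (H n).2 -> models H d.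
Proof.
move=> Hdec gsurj Hg Hcomplete /finitely_presented_presents.
move=> [Y [n [E [v [vsurj Ev univ]]]]].
have [s sE] := choice (fun y => gsurj (v y)).
have [r rE] := choice (fun x => vsurj (g x)).
pose sub (u : term S Y) : term S X := eval (A := term_algebra S X) s u.
have subE D (d : X -> D) u : eval d (sub u) = eval (fun y => eval d (s y)) u.
  exact: (hom_eval (A := term_algebra S X) s u (@eval_hom _ D X d)).
have gsub u : eval g (sub u) = eval v u.
  by rewrite subE; congr eval; apply/funext => y; apply: sE.
(* The right summand records that [g x], expressed over [Y] by [r x] and translated back, is [x]
   again; this will force [h \o g = d]. *)
pose F (i : 'I_n + X) : term S X * term S X :=
  match i with
  | inl i => (sub (E i).1, sub (E i).2)
  | inr x => (sub (r x), Var S x)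
  end.
have [|k kP] := chain_compactness Hdec (E := F).
  move=> D VD d Hd [i|x]; apply: (Hcomplete D VD d Hd) => /=.
    by rewrite !gsub Ev.
  by rewrite gsub rE.
exists k => D VD d Hd; have Fd := kP D VD d Hd.
have [|h hh hE] := univ D VD (fun y => eval d (s y)).
  by move=> i; have := Fd (inl i); rewrite /= !subE.
have hg : h \o g = d.
  apply/funext => x /=; rewrite -rE hom_eval //.
  have := Fd (inr x); rewrite /= subE => <-.
  by congr eval; apply/funext.
by move=> i; rewrite -hg -!hom_eval // Hg.
Qed.

End Variety.

(** * The meet order and the potency of [t] *)

Section Meets.
Variables (S : signature) (m : term S bool) (A : algebra S).
Hypotheses (mA : associative (@op2 S m A)) (mC : commutative (@op2 S m A)).

Lemma leA_trans (y x z : A) : leA m x y -> leA m y z -> leA m x z.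
Proof. by rewrite /leA => xy yz; rewrite -xy -mA yz. Qed.

Lemma leA_anti (x y : A) : leA m x y -> leA m y x -> x = y.
Proof. by rewrite /leA mC => ->. Qed.

End Meets.

Theorem theorem3p1 (S : signature) (hS : exists c : S, arity c = 0)
  (V : algebra S -> Prop) (hV : variety V) (hcoh : coherent V)
  (m : term S bool) (hm : semilattice_term V m)
  (t : term S unit)
  (ht_le : forall A : algebra S, V A -> forall x : A, leA m (op1 t x) x)
  (ht_mono : forall A : algebra S, V A -> forall x y : A,
     leA m x y -> leA m (op1 t x) (op1 t y))
  (hfix : fixpoint_embedding V m t) :
  exists n : nat, potent V n t.
Proof.
pose le X (s s' : term S X) : term S X * term S X :=
  (op2 (A := term_algebra S X) m s s', s).
have leE (A : algebra S) X (v : X -> A) s s' :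
    (eval v (le X s s').1 = eval v (le X s s').2) = leA m (eval v s) (eval v s').
  by rewrite /= (hom_op2 m _ _ (@eval_hom _ A X v)).
have trans A (VA : V A) := @leA_trans _ m A (let: And3 a _ _ := hm A VA in a).
pose pow X k (s : term S X) : term S X := iter k (@op1 S t (term_algebra S X)) s.
have powE (A : algebra S) X (v : X -> A) k s : eval v (pow X k s) = iter k (@op1 S t A) (eval v s).
  by elim: k => //= k <-; rewrite (hom_op1 t _ (@eval_hom _ A X v)).
(* The generator [true] is x, [false] is z, and [None] is the fixpoint w. *)
pose H k := le bool (Var S false) (pow bool k (Var S true)).
have HE (A : algebra S) (v : bool -> A) k : (eval v (H k).1 = eval v (H k).2) =
    leA m (v false) (iter k (@op1 S t A) (v true)) by rewrite leE powE.
pose z := Var S (Some false); pose x := Var S (Some true).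
pose w := Var S (@None bool).
(* Here [option bool] serves as a type of three relation labels, unrelated to its use as the type of
   generators. *)
pose E (i : option bool) := match i with
  | Some true => le _ z w
  | Some false => le _ w x
  | None => (op1 (A := term_algebra S (option bool)) t w, w)
  end.
have [A [VA fpA [v [_ Ev univ]]]] := presentation_exists hV E.
have zw : leA m (v (Some false)) (v None) by have := Ev (Some true); rewrite leE.
have wx : leA m (v None) (v (Some true)) by have := Ev (Some false); rewrite leE.
have tw : op1 t (v None) = v None.
  by have := Ev None; rewrite /= (hom_op1 t _ (@eval_hom _ A _ v)).
pose g := v \o Some.
have fpG : finitely_presented V (generated g).
  by apply: (hcoh _ VA fpA); apply: generated_fg.
have Hg : models H (gen g).
  move=> k; apply: sval_inj.
  rewrite !(hom_eval _ _ (sval_hom (HB := _))) HE /=.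
  apply: (trans _ VA (v None)) => //.
  (* The induction shows w <= t^k(x): from w = t(w) and monotonicity, each bound passes to the next
     power. *)
  elim: k => //= k IH; rewrite -tw; exact: ht_mono.
have Hdec D : V D -> forall (d : bool -> D) k,
    eval d (H k.+1).1 = eval d (H k.+1).2 -> eval d (H k).1 = eval d (H k).2.
  by move=> VD d k; rewrite !HE => /(trans _ VD); apply; apply: ht_le.
(* The subalgebra generated by [d] embeds by [e] into some [B] where the powers of [t] at x have a
   meet [b] fixed by [t]. Sending w to [b] gives a homomorphism from [A] to [B] agreeing with [e] on
   x and z, so equations between x and z move from [A] to [B] and back along the injective [e]. *)
have complete D : V D -> forall d : bool -> D, models H d ->
    forall s s', eval (gen g) s = eval (gen g) s' -> eval d s = eval d s'.
  move=> VD d Hd s s' ss'.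
  (* The embedding condition asks for a finitely generated algebra, so [D] is replaced by the
     subalgebra generated by [d]. *)
  have VGd : V (generated d) by apply: (variety_sub hV).
  have Hd' : models H (gen d).
    move=> k; apply: sval_inj.
    by rewrite !(hom_eval _ _ (sval_hom (HB := _))) Hd.
  have [B [VB [e [he einj [b [bl bg] bt]]]]] :=
    hfix _ VGd (generated_fg d) (gen d true).
  have zb : leA m (e (gen d false)) b.
    apply: bg => _ [k _ <-]; rewrite op1_tpow.
    by have := congr1 e (Hd' k); rewrite !(hom_eval _ _ he) HE.
  have bx : leA m b (e (gen d true)).
    (* x is the power t^0(x), one of the elements whose meet is [b]. *)
    by apply: bl; exists 0.
  pose u o := if o is Some i then e (gen d i) else b.
  have [|h hh hE] := univ _ VB u.
    move=> [[]|]; rewrite ?leE //=.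
    by rewrite (hom_op1 t _ (@eval_hom _ B _ u)) -bt.
  have hg r : h (sval (eval (gen g) r)) = e (eval (gen d) r).
    rewrite (hom_eval _ r (sval_hom (HB := _))) !hom_eval //.
    by congr eval; apply/funext => i /=; rewrite hE.
  have /einj/(congr1 sval) : e (eval (gen d) s) = e (eval (gen d) s').
    by rewrite -!hg ss'.
  by rewrite !(hom_eval _ _ (sval_hom (HB := _))).
have [n nP] :=
  finitely_presented_chain hV Hdec (@gen_surj _ _ _ g) Hg complete fpG.
exists n => D VD a; rewrite !eval_tpow.
have [mA mC mI] := hm _ VD.
apply: (leA_anti mC); first exact: ht_le.
(* With x sent to a and z to t^n(a), [H n] is idempotence of the meet and [H n.+1] is the remaining
   inequality. *)
pose d b := if b then a tt else iter n (@op1 S t D) (a tt).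
have := nP D VD d; rewrite HE => /(_ (mI _)) /(_ n.+1).
by rewrite HE.
Qed.
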